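(* Let $P\in\mathbb{R}^{n\times n}$ be a row-stochastic matrix. The RLGL dynamics associated with $P$ can be represented as gradient descent on a quadratic energy if and only if $P$ is similar to a symmetric matrix. Explicitly: there exist an invertible matrix $M\in\mathbb{R}^{n\times n}$ and a quadratic form $\Phi:\mathbb{R}^n\to\mathbb{R}$ such that the residue field expressed in the coordinates $y=xM$ satisfies $\tilde r(y)=\nabla\Phi(y)$ for all $y\in\mathbb{R}^n$, if and only if there exists an invertible matrix $N\in\mathbb{R}^{n\times n}$ such that $N^{-1}PN$ is symmetric.
   Context: Vectors are row vectors and gradients are row vectors. The RLGL update with block $B_t\subseteq\{1,\dots,n\}$ is $x_{t+1}=x_t-x_t(I-P)I_{B_t}$, where $I_{B}$ is the diagonal $0/1$ matrix projecting on the coordinates in $B$. The residue field (the direction subtracted in the update) is $r(x)=x(I-P)$. Under an invertible linear change of coordinates $y=xM$, it becomes $\tilde r(y)=r(yM^{-1})M=y(I-M^{-1}PM)$. ''The RLGL dynamics can be represented as gradient descent on a quadratic energy'' means that for some invertible real $M$ the field $\tilde r$ is the gradient field of a quadratic form $\Phi(y)=\tfrac12 yHy^\top$ with $H\in\mathbb{R}^{n\times n}$. *)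

(* Defs.v *)
From HB Require Import structures.
From mathcomp Require Import all_boot all_order all_algebra.
From mathcomp Require Import sesquilinear.
From mathcomp Require Import boolp classical_sets reals topology normedtype derive.

Set Implicit Arguments.
Unset Strict Implicit.
Unset Printing Implicit Defensive.

Import Order.TTheory GRing.Theory Num.Theory.
Import numFieldNormedType.Exports.

Local Open Scope ring_scope.

Definition row_stochastic (R : realType) (n : nat) (P : 'M[R]_n) : Prop :=
  (forall i j, 0 <= P i j) /\ (forall i, \sum_j P i j = 1).

Definition coord_proj (R : realType) (n : nat) (B : {set 'I_n}) : 'M[R]_n :=
  diag_mx (\row_i (i \in B)%:R).

Definition residue (R : realType) (n : nat) (P : 'M[R]_n) (x : 'rV[R]_n) :
    'rV[R]_n :=
  x *m (1%:M - P).

(* Not used by the other definitions: it records the RLGL update, in which the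
   residue, restricted to the block B, is the subtracted direction. *)
Definition rlgl_step (R : realType) (n : nat) (P : 'M[R]_n) (B : {set 'I_n})
    (x : 'rV[R]_n) : 'rV[R]_n :=
  x - residue P x *m coord_proj R B.

(* The residue field in the coordinates y = x *m M, for M in unitmx. *)
Definition residue_in (R : realType) (n : nat) (M P : 'M[R]_n)
    (y : 'rV[R]_n) : 'rV[R]_n :=
  residue P (y *m invmx M) *m M.

(* H is not required to be symmetric. *)
Definition quadratic_form (R : realType) (n : nat) (Phi : 'rV[R]_n -> R) :
    Prop :=
  exists H : 'M[R]_n, forall y, Phi y = 2^-1 * (y *m H *m y^T) ord0 ord0.

Definition gradient (R : realType) (n : nat) (Phi : 'rV[R]_n -> R)
    (y : 'rV[R]_n) : 'rV[R]_n :=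
  \row_j (derive Phi y (delta_mx ord0 j) : R).

(* derive is a total function (a limit with a default value), hence the
   explicit differentiability. *)
Definition gradient_field (R : realType) (n : nat) (Phi : 'rV[R]_n -> R)
    (r : 'rV[R]_n -> 'rV[R]_n) : Prop :=
  forall y, differentiable Phi y /\ r y = gradient Phi y.

(* Main.v *)
(** The gradient of [2^-1 * y H y^T] is [y S] with [S = (H + H^T) / 2], the
    symmetric part of [H], while the residue field in the coordinates [y = x M]
    is [y (1 - M^-1 P M)].  So the latter is such a gradient exactly when
    [M^-1 P M] is symmetric, and one can take [N = M] in both directions. *)

Require Import Defs.
From mathcomp Require Import all_boot all_order all_algebra.
From mathcomp Require Import sesquilinear reals.
From mathcomp Require Import boolp classical_sets functions topology normedtype derive.
From mathcomp Require Import ring.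

Import Order.TTheory GRing.Theory Num.Theory.
Import numFieldNormedType.Exports.

Local Open Scope ring_scope.

(** Both sides are [1 x 1] matrices and transposes of each other. *)
Lemma mulmx_row_trC (R : comNzRingType) (n : nat) (u v : 'rV[R]_n) :
  u *m v^T = v *m u^T.
Proof.
by rewrite -[LHS]trmxK trmx_mul trmxK [LHS]mx11_scalar [RHS]mx11_scalar mxE.
Qed.

Lemma symmetricmxP (R : fieldType) (n : nat) (A : 'M[R]_n) :
  reflect (A^T = A) (A \is symmetricmx).
Proof.
(* [symmetricmx] is the Hermitian predicate with sign [(-1) ^+ 0] and the identity as conjugation;
   both simplify away. *)
have -> : (A \is symmetricmx) = (A == A^T).
  by rewrite is_hermitianmxE expr0 scale1r map_mx_id.
by rewrite eq_sym; apply: eqP.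
Qed.

Lemma differentiable_quadratic (R : realType) (n : nat) (H : 'M[R]_n)
    (y : 'rV[R]_n) :
  differentiable (fun z : 'rV[R]_n => 2^-1 * (z *m H *m z^T) ord0 ord0 : R) y.
Proof.
(* Written as a polynomial in the coordinate functions, the form inherits their
   differentiability. *)
have -> : (fun z : 'rV[R]_n => 2^-1 * (z *m H *m z^T) ord0 ord0 : R) =
    cst (2^-1) \* \sum_(j < n) ((\sum_(i < n)
      ((fun z : 'rV[R]_n => z ord0 i) \* cst (H i j)))
      \* (fun z : 'rV[R]_n => z ord0 j)).
  apply/funext => z; rewrite mxE /= fct_sumE; congr (_ * _).
  apply: eq_bigr => j _; rewrite !mxE /= fct_sumE.
  by congr (_ * _).
apply: differentiableM => //.
apply: differentiable_sum => j; apply: differentiableM.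
  apply: differentiable_sum => i.
  by apply: differentiableM => //; exact: differentiable_coord.
exact: differentiable_coord.
Qed.

Lemma derive_quadratic (R : realType) (n : nat) (H : 'M[R]_n)
    (y v : 'rV[R]_n) :
  derive (fun z : 'rV[R]_n => 2^-1 * (z *m H *m z^T) ord0 ord0 : R) y v =
  (y *m (2^-1 *: (H + H^T)) *m v^T) ord0 ord0.
Proof.
(* For [h != 0] the difference quotient is exactly [c + h * d]: [d] is the form at [v], and the two
   cross terms make up [c]. *)
set c := RHS; pose d := 2^-1 * (v *m H *m v^T) ord0 ord0.
apply: cvg_lim => //=.
apply: (@cvg_trans _ ((fun h : R => c + h * d) @ (0 : R)^')%classic).
  apply: near_eq_cvg; near=> h.
  have h0 : h != 0 by near: h; exact: nbhs_dnbhs_neq.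
  have yHv : y *m H^T *m v^T = v *m H *m y^T.
    by rewrite -mulmxA -trmx_mul mulmx_row_trC.
  rewrite /c /d -scalemxAr -scalemxAl mulmxDr (mulmxDl (y *m H)) yHv.
  have -> : (h *: v + y)^T = h *: v^T + y^T by rewrite linearD linearZ.
  rewrite !mulmxDl !mulmxDr -!scalemxAl -!scalemxAr.
  (* With the four products abstracted, a scalar identity remains, in which [h0] allows division by
     [h]. *)
  move: (v *m H *m v^T) (v *m H *m y^T) (y *m H *m v^T) (y *m H *m y^T).
  by move=> vv vy yv yy; rewrite !mxE /GRing.scale /=; field.
(* The limit becomes the value of [c + h * d] at [h = 0], so continuity there suffices. *)
have -> : nbhs c = nbhs (c + 0 * d) by rewrite mul0r addr0.
apply: cvg_within_filter.
apply: cvgD; first exact: cvg_cst.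
by apply: cvgM; [exact: cvg_id | exact: cvg_cst].
Unshelve. all: by end_near.
Qed.

Lemma gradient_quadratic (R : realType) (n : nat) (H : 'M[R]_n)
    (y : 'rV[R]_n) :
  gradient (fun z : 'rV[R]_n => 2^-1 * (z *m H *m z^T) ord0 ord0) y =
  y *m (2^-1 *: (H + H^T)).
Proof.
by apply/rowP => j; rewrite mxE derive_quadratic trmx_delta -colE mxE.
Qed.

Lemma residue_inE (R : realType) (n : nat) (M P : 'M[R]_n) (y : 'rV[R]_n) :
  M \in unitmx -> residue_in M P y = y *m (1%:M - invmx M *m P *m M).
Proof.
move=> Mu; rewrite /residue_in /residue !mulmxBr !mulmx1 mulmxBl.
by rewrite mulmxKV // !mulmxA.
Qed.

Theorem lemma2 (R : realType) (n : nat) (P : 'M[R]_n)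
    (hP : row_stochastic P) :
  (exists (M : 'M[R]_n) (Phi : 'rV[R]_n -> R),
     [/\ M \in unitmx, quadratic_form Phi
       & gradient_field Phi (residue_in M P)])
  <->
  (exists N : 'M[R]_n,
     N \in unitmx /\ (invmx N *m P *m N) \is symmetricmx).
Proof.
split=> [[M [Phi [Mu [H PhiE] grad]]] | [N [Nu /symmetricmxP symA]]].
  exists M; split=> //; apply/symmetricmxP; set A := invmx M *m P *m M.
  move/funext: PhiE grad => -> grad.
  have AE : A = 1%:M - 2^-1 *: (H + H^T).
    (* The gradient identity at the [i]-th basis vector is the equality of the [i]-th rows of
       [1%:M - A] and the symmetric part of [H]. *)
    apply/esym/eqP; rewrite subr_eq addrC -subr_eq; apply/eqP/row_matrixP => i.
    have [_] := grad (row i 1%:M).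
    by rewrite residue_inE // gradient_quadratic -!row_mul !mul1mx.
  by rewrite AE; apply/matrixP => i j; rewrite !mxE eq_sym [H j i + _]addrC.
set A := invmx N *m P *m N in symA.
exists N, (fun z => 2^-1 * (z *m (1%:M - A) *m z^T) ord0 ord0).
split=> //; first by exists (1%:M - A).
move=> y; split; first exact: differentiable_quadratic.
rewrite residue_inE // gradient_quadratic -/A; congr (_ *m _).
(* The chosen [H = 1%:M - A] is symmetric, hence equal to its symmetric part. *)
have -> : (1%:M - A)^T = 1%:M - A by rewrite raddfB /= trmx1 symA.
by rewrite scalerDr -scalerDl -div1r -splitr scale1r.
Qed.
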